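(* Let $R$ be an integral domain which is not a field, with quotient field $L$. Then $R$ is $t$-linked under each overring $T$ of $R$ with $T\neq L$ if and only if $R$ is a one-dimensional local domain.
   Context: An overring of $R$ is a ring $T$ with $R\subseteq T\subseteq L$. For an ideal $I$ of $R$, $I^{-1}=(R:I)=\{x\in L: xI\subseteq R\}$ and $(T:IT)=\{x\in L: xIT\subseteq T\}$. $R$ is $t$-linked under $T$ if, for each finitely generated ideal $I$ of $R$, $(T:IT)=T$ implies $I^{-1}=R$. A local domain is a domain with exactly one maximal ideal (not assumed Noetherian). *)

(* Defs.v *)
From mathcomp Require Import all_boot all_algebra.
From mathcomp Require Import boolp classical_sets.

Set Implicit Arguments.
Unset Strict Implicit.
Unset Printing Implicit Defensive.

Import GRing.Theory.
Local Open Scope ring_scope.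
Local Open Scope classical_set_scope.

(* [idealr_closed] includes 1 \notin P. *)
Definition proper_ideal_set (R : idomainType) (P : set R) : Prop :=
  idealr_closed [in P].

Definition prime_ideal (R : idomainType) (P : set R) : Prop :=
  proper_ideal_set P /\ prime_idealr_closed [in P].

Definition maximal_ideal (R : idomainType) (M : set R) : Prop :=
  proper_ideal_set M /\
  forall J : set R, proper_ideal_set J -> M `<=` J -> J = M.

Definition local_domain (R : idomainType) : Prop :=
  exists! M : set R, maximal_ideal M.

(* P 0 < P 1 < ... < P n; the values of P beyond n are irrelevant. *)
Definition prime_chain (R : idomainType) (n : nat) (P : nat -> set R) : Prop :=
  (forall i, (i <= n)%N -> prime_ideal (P i)) /\
  (forall i, (i < n)%N -> P i `<` P i.+1).

Definition has_krull_dim (R : idomainType) (n : nat) : Prop :=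
  (exists P : nat -> set R, prime_chain n P) /\
  (forall m (P : nat -> set R), prime_chain m P -> (m <= n)%N).

Definition fin_gen_ideal (R : idomainType) (I : set R) : Prop :=
  exists (n : nat) (g : 'I_n -> R),
    I = [set x | exists c : 'I_n -> R, x = \sum_(i < n) c i * g i].

(* The image of R in its quotient field. *)
Definition base_ring (R : idomainType) : set {fraction R} :=
  range (@tofrac R).
Arguments base_ring R : clear implicits.

Definition overring (R : idomainType) (T : set {fraction R}) : Prop :=
  subring_closed [in T] /\ base_ring R `<=` T.

(* (A : B) *)
Definition colon (L : fieldType) (A B : set L) : set L :=
  [set x | forall b, B b -> A (x * b)].

(* IT *)
Definition extended_ideal (R : idomainType) (I : set R) (T : set {fraction R})
    : set {fraction R} :=
  [set x | exists (n : nat) (a : 'I_n -> R) (t : 'I_n -> {fraction R}),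
     [/\ forall i, I (a i), forall i, T (t i)
       & x = \sum_(i < n) tofrac (a i) * t i]].

Definition ideal_inverse (R : idomainType) (I : set R) : set {fraction R} :=
  colon (base_ring R) (@tofrac R @` I).

Definition t_linked_under (R : idomainType) (T : set {fraction R}) : Prop :=
  forall I : set R, fin_gen_ideal I ->
    colon T (extended_ideal I T) = T -> ideal_inverse I = base_ring R.

(* Main.v *)
(* If P is a nonzero prime, then R_P <> L, and for a outside P the ideal (a)
   satisfies (R_P : a R_P) = R_P.  When R is t-linked under R_P this gives
   1/a in (a)^{-1} = R, so a is a unit.  Hence every nonzero prime is the set of
   nonunits, which makes R local of dimension one.

   Conversely, let R be local of dimension one, T <> L an overring, and choose
   a <> 0 in R with 1/a not in T.  Every nonunit has a power in aR, since a prime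
   containing a but no power of it would sit strictly between 0 and the maximal
   ideal.  If I is generated by nonunits and (T : IT) = T, iterating this
   equality on 1/a yields 1/a in T; so some generator of I is a unit. *)

Require Import Defs.
From mathcomp Require Import all_boot all_algebra.
From mathcomp Require Import boolp classical_sets.

Set Implicit Arguments.
Unset Strict Implicit.
Unset Printing Implicit Defensive.

Import GRing.Theory.
Local Open Scope ring_scope.
Local Open Scope classical_set_scope.

(** * Proper ideals and prime ideals as subsets *)

Lemma proper_ideal_setP (R : idomainType) (P : set R) :
  proper_ideal_set P <->
  [/\ P 0, ~ P 1 & forall a u v, P u -> P v -> P (a * u + v)].
Proof.
split=> [[P0 P1 PD]|[P0 P1 PD]].
- split; first by move: P0; rewrite in_setE.
    by move=> /mem_set; apply/negP.
  by move=> a u v /mem_set Pu /mem_set Pv; apply: set_mem; exact: PD.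
- split; [exact: mem_set | by apply/negP => /set_mem |].
  by move=> a u v /set_mem Pu /set_mem Pv; apply: mem_set; exact: PD.
Qed.

Lemma prime_idealP (R : idomainType) (P : set R) :
  prime_ideal P <->
  proper_ideal_set P /\ forall u v, P (u * v) -> P u \/ P v.
Proof.
split=> [[idP prP]|[idP prP]]; split=> // u v.
- by move=> /mem_set /prP /orP[] /set_mem; [left | right].
- by move=> /set_mem /prP[] Px; apply/orP; [left | right]; apply: mem_set.
Qed.

Section ProperIdeal.
Variables (R : idomainType) (P : set R) (idP : proper_ideal_set P).

Lemma ideal0 : P 0. Proof. by have /proper_ideal_setP[] := idP. Qed.

Lemma ideal1N : ~ P 1. Proof. by have /proper_ideal_setP[] := idP. Qed.

Lemma idealMl a u : P u -> P (a * u).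
Proof.
have /proper_ideal_setP[P0 _ PD] := idP.
by move=> Pu; rewrite -[a * u]addr0; exact: PD.
Qed.

Lemma idealD u v : P u -> P v -> P (u + v).
Proof.
have /proper_ideal_setP[_ _ PD] := idP.
by move=> Pu Pv; rewrite -[u]mul1r; exact: PD.
Qed.

Lemma ideal_unitN u : P u -> u \isn't a GRing.unit.
Proof.
move=> Pu; apply/negP => uU; apply: ideal1N.
by rewrite -(mulVr uU); exact: idealMl.
Qed.

Lemma ideal_nonzero : P != [set 0] -> exists2 a, P a & a != 0.
Proof.
move=> Pn0; apply: contrapT => Pz; move/eqP: Pn0; apply.
apply/seteqP; split=> [x Px /=|_ ->]; last exact: ideal0.
by apply: contrapT => /eqP x0; apply: Pz; exists x.
Qed.

End ProperIdeal.

Lemma set0_prime (R : idomainType) : prime_ideal [set (0 : R)].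
Proof.
apply/prime_idealP; split.
  apply/proper_ideal_setP; split=> //=; first by apply/eqP; exact: oner_neq0.
  by move=> a u v -> ->; rewrite mulr0 addr0.
by move=> u v /= /eqP; rewrite mulf_eq0 => /orP[] /eqP; [left | right].
Qed.

Lemma principal_proper (R : idomainType) (a : R) :
  a \isn't a GRing.unit -> proper_ideal_set (range ( *%R^~ a)).
Proof.
move=> aNU; apply/proper_ideal_setP; split.
- by exists 0; rewrite ?mul0r.
- move=> [b _ ba]; move/negP: aNU; apply; apply/unitrP; exists b.
  by rewrite [a * b]mulrC ba.
- by move=> c _ _ [u _ <-] [v _ <-]; exists (c * u + v); rewrite // mulrDl mulrA.
Qed.

(** * Primes avoiding a multiplicative set *)

Section AvoidingPrime.
Variables (R : idomainType) (S : set R).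
Hypotheses (S1 : S 1) (SM : forall s t, S s -> S t -> S (s * t)).

Let avoiding (P : set R) := proper_ideal_set P /\ forall s, S s -> ~ P s.

(** For u, v outside P, maximality makes both P + (u) and P + (v) meet S. The product of the two
    elements of S found there lies in P + (uv), so it would lie in P if uv did. *)
Lemma maximal_avoiding_prime (P : set R) :
  avoiding P -> (forall K, avoiding K -> P `<=` K -> K = P) -> prime_ideal P.
Proof.
move=> [idP PS] Pmax; apply/prime_idealP; split=> // u v Puv.
have extend w : ~ P w -> exists s r, S s /\ P (s - r * w).
  move=> Pw; apply: contrapT => noS.
  (* [K] is the ideal P + (w). If it missed S, maximality would force [K] = P, hence w in P. *)
  pose K := [set x | exists r, P (x - r * w)].
  have KS s : S s -> ~ K s by move=> Ss [r Pr]; apply: noS; exists s, r.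
  have idK : proper_ideal_set K.
    apply/proper_ideal_setP; split; last 1 first.
    - move=> a x y [r Pr] [t Pt]; exists (a * r + t).
      have -> : a * x + y - (a * r + t) * w = a * (x - r * w) + (y - t * w).
        by rewrite mulrBr mulrDl opprD mulrA addrACA.
      by apply: idealD => //; exact: idealMl.
    - by exists 0; rewrite mul0r subr0; exact: ideal0.
    - exact: KS.
  apply: Pw; rewrite -(Pmax K) //; last first.
    by move=> x Px; exists 0; rewrite mul0r subr0.
  by exists 1; rewrite mul1r subrr; exact: ideal0.
apply: contrapT => /not_orP[/extend[s [r [Ss Pr]]] /extend[t [q [St Pq]]]].
apply: (PS _ (SM Ss St)).
(* Each summand is a multiple of an element of P. *)
have -> : s * t = t * (s - r * u) + (r * u) * (t - q * v) + (r * q) * (u * v).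
  rewrite !mulrBr [t * s]mulrC [t * (r * u)]mulrC addrA subrK.
  by rewrite [r * u * (q * v)]mulrACA subrK.
by apply: idealD; [|apply: idealD|] => //; exact: idealMl.
Qed.

Lemma exists_avoiding_prime (J : set R) : avoiding J ->
  exists P, [/\ prime_ideal P, J `<=` P, forall s, S s -> ~ P s
    & forall K, avoiding K -> P `<=` K -> K = P].
Proof.
move=> avJ.
(* Working with J `|` A rather than A makes the empty chain harmless in Zorn's lemma. *)
have [F FZ Ftot|A [avA Amax]] :=
    @Zorn_bigcup R [set A | avoiding (J `|` A)].
  (* Any two elements of the union share one avoiding ideal inside it: [J] itself, or [J] joined
     with the larger of two chain members. Every closure condition is then checked there. *)
  have sup u v : (J `|` \bigcup_(X in F) X) u ->
      (J `|` \bigcup_(X in F) X) v ->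
    exists X, [/\ avoiding X, X `<=` J `|` \bigcup_(X in F) X, X u & X v].
    have sub X : F X -> J `|` X `<=` J `|` \bigcup_(X in F) X.
      by move=> FX x [Jx|Xx]; [left | right; exists X].
    move=> [Ju|[X FX Xu]] [Jv|[Y FY Yv]].
    - by exists J; split=> // x Jx; left.
    - by exists (J `|` Y); split; [exact: FZ | exact: sub | left | right].
    - by exists (J `|` X); split; [exact: FZ | exact: sub | right | left].
    - have [XY|YX] := Ftot _ _ FX FY.
        exists (J `|` Y); split; [exact: FZ | exact: sub | | by right].
        by right; exact: XY.
      exists (J `|` X); split; [exact: FZ | exact: sub | by right |].
      by right; exact: YX.
  have US s : S s -> ~ (J `|` \bigcup_(X in F) X) s.
    by move=> Ss Us; have [X [[_ XS] _ Xs _]] := sup _ _ Us Us; exact: XS Xs.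
  split=> //; apply/proper_ideal_setP; split; last 1 first.
  - move=> a u v Uu Uv; have [X [[idX _] sX Xu Xv]] := sup _ _ Uu Uv.
    by apply: sX; apply: idealD => //; exact: idealMl.
  - by left; apply: ideal0; case: avJ.
  - exact: US.
have Pmax K : avoiding K -> J `|` A `<=` K -> K = J `|` A.
  move=> avK sK; apply/seteqP; split=> // x Kx; apply: contrapT => Ax.
  have JK : J `|` K = K by apply/setUidPr => y Jy; apply: sK; left.
  (* Zorn's lemma makes [A] maximal, not the union with [J]; since [K] contains [J], it is itself a
     candidate, and [x] makes it strictly larger than [A]. *)
  apply: (Amax K); last by rewrite /= JK.
  split; first by move=> y Ay; apply: sK; right.
  by move=> /(_ x Kx) ?; apply: Ax; right.
exists (J `|` A); split=> //; last by case: avA.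
exact: maximal_avoiding_prime.
Qed.

End AvoidingPrime.

(** Avoiding {1} is the same as being proper, so an ideal maximal among those avoiding {1} is a
    maximal ideal. *)
Lemma exists_maximal_prime (R : idomainType) (J : set R) :
  proper_ideal_set J ->
  exists M, [/\ prime_ideal M, maximal_ideal M & J `<=` M].
Proof.
move=> idJ.
have [|||M [prM JM _ Mmax]] := @exists_avoiding_prime R [set 1] _ _ J.
- by [].
- by move=> s t /= -> ->; rewrite mulr1.
- by split=> // s /= ->; exact: ideal1N.
exists M; split=> //; split; first by case: prM.
by move=> K idK; apply: Mmax; split=> // s /= ->; exact: ideal1N.
Qed.

Lemma exists_maximal_prime_nonunit (R : idomainType) (a : R) :
  a \isn't a GRing.unit ->
  exists P, [/\ prime_ideal P, maximal_ideal P & P a].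
Proof.
move=> /principal_proper /exists_maximal_prime[M [prM maxM sM]].
by exists M; split=> //; apply: sM; exists 1; rewrite ?mul1r.
Qed.

(** * Fractions, overrings and colons *)

Lemma fraction_num_den (R : idomainType) (x : {fraction R}) :
  exists n d, d != 0 /\ x = tofrac n / tofrac d.
Proof.
elim/quotW: x => r; exists (frac r).1, (frac r).2.
have d0 := denom_ratioP r; split=> //.
have d0F : tofrac (frac r).2 != 0 by rewrite tofrac_eq0.
(* Clearing the denominator leaves an equality of classes of ratios, checked by
   cross-multiplication. *)
apply: (mulIf d0F); rewrite divfK //; unlock tofrac.
rewrite -[LHS]pi_mul; apply/eqmodP.
rewrite /= /FracField.equivf /FracField.mulf /=.
rewrite !numden_Ratio ?mulf_neq0 ?oner_neq0 //.
by rewrite !mulr1 mulrC.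
Qed.


Section Overring.
Variables (R : idomainType) (T : set {fraction R}) (ovT : overring T).

Lemma overringM x y : T x -> T y -> T (x * y).
Proof.
have [[_ _ TM] _] := ovT.
by move=> /mem_set Tx /mem_set Ty; apply: set_mem; exact: TM.
Qed.

Lemma overring_tofrac a : T (tofrac a).
Proof. by have [_ sRT] := ovT; apply: sRT; exists a. Qed.

Lemma overring_sum n (F : 'I_n -> {fraction R}) :
  (forall i, T (F i)) -> T (\sum_(i < n) F i).
Proof.
have [[_ TB _] _] := ovT.
have T0 : T 0 by rewrite -(rmorph0 (@tofrac R)); exact: overring_tofrac.
have TB' x y : T x -> T y -> T (x - y).
  by move=> /mem_set Tx /mem_set Ty; apply: set_mem; exact: TB.
move=> TF; apply: big_ind => // x y Tx Ty.
by rewrite -[y]opprK -[- y]sub0r; apply: (TB' _ _ Tx (TB' _ _ _ Ty)).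
Qed.

(** If T contained every 1/d, it would contain every n/d. *)
Lemma overring_noninvertible :
  T <> [set: {fraction R}] -> exists2 a, a != 0 & ~ T (tofrac a)^-1.
Proof.
move=> TnL; apply: contrapT => noa; apply: TnL.
rewrite -subTset => x _; have [n [d [d0 ->]]] := fraction_num_den x.
apply: overringM; first exact: overring_tofrac.
by apply: contrapT => Td; apply: noa; exists d.
Qed.

Lemma colon_generators n (g : 'I_n -> R) y :
  (forall i, T (y * tofrac (g i))) ->
  colon T (extended_ideal
    [set x | exists c : 'I_n -> R, x = \sum_(i < n) c i * g i] T) y.
Proof.
move=> Tyg _ [m [a [t [Ia Tt ->]]]]; rewrite mulr_sumr.
apply: overring_sum => j; rewrite mulrA; apply: overringM => //.
have [c ->] := Ia j; rewrite rmorph_sum mulr_sumr.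
apply: overring_sum => i; rewrite rmorphM mulrCA.
by apply: overringM; [exact: overring_tofrac | exact: Tyg].
Qed.

(* If y g_i^(k_i) lies in T for all i and no k_i is 0, then each y g_i has the same
   property with k_i lowered by 1, so y g_i is in T and y is in (T : IT) = T. *)
Lemma colon_power n (g : 'I_n -> R) (k : 'I_n -> nat) y :
  colon T (extended_ideal
    [set x | exists c : 'I_n -> R, x = \sum_(i < n) c i * g i] T) = T ->
  (forall i, T (y * tofrac (g i) ^+ k i)) -> T y.
Proof.
move=> colT; have [N] := ubnP (\sum_(i < n) k i)%N.
elim: N k y => // N IHN k y; rewrite ltnS => kN Tyg.
have [/existsP[i /eqP ki0]|/existsPn kn0] := boolP [exists i, k i == 0%N].
  by have := Tyg i; rewrite ki0 mulr1.
rewrite -colT; apply: colon_generators => i.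
apply: (IHN (fun j => k j - (j == i))%N) => [|j].
  apply: leq_trans kN; rewrite [ltnRHS](bigD1 i) //= (bigD1 i) //= eqxx.
  rewrite -addSn leq_add ?subn1 ?prednK ?lt0n //.
  by apply: leq_sum => j _; exact: leq_subr.
have [->|ji] := eqVneq j i; last first.
  rewrite subn0 mulrAC; apply: overringM => //; exact: overring_tofrac.
by rewrite subn1 -mulrA -exprS prednK ?lt0n.
Qed.

(** Here a is a unit of T, so aT = T, and testing y against 1 in aT gives y in T. *)
Lemma colon_unit a : a != 0 -> T (tofrac a)^-1 ->
  colon T (extended_ideal
    [set x | exists c : 'I_1 -> R, x = \sum_(i < 1) c i * a] T) = T.
Proof.
move=> a0 TaV; apply/seteqP; split=> y Ty.
  rewrite -[y]mulr1; apply: Ty.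
  exists 1%N, (fun=> a), (fun=> (tofrac a)^-1); split=> //.
    by move=> i; exists (fun=> 1); rewrite big_ord1 mul1r.
  by rewrite big_ord1 divff // tofrac_eq0.
apply: (@colon_generators 1 (fun=> a)) => i.
by apply: overringM => //; exact: overring_tofrac.
Qed.

End Overring.

(** * Localization at a prime *)

Definition localization (R : idomainType) (P : set R) : set {fraction R} :=
  [set x | exists n d, ~ P d /\ x = tofrac n / tofrac d].

Section Localization.
Variables (R : idomainType) (P : set R) (prP : prime_ideal P).

Let idP : proper_ideal_set P := prP.1.

Let notP_neq0 d : ~ P d -> d != 0.
Proof. by apply: contra_notN => /eqP ->; exact: ideal0. Qed.

Let notP_mul d e : ~ P d -> ~ P e -> ~ P (d * e).
Proof. by move=> Pd Pe /((prime_idealP P).1 prP).2[]. Qed.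

Lemma localization_overring : overring (localization P).
Proof.
split; last first.
  move=> _ [a _ <-]; exists a, 1; split; first exact: ideal1N.
  by rewrite rmorph1 divr1.
split.
- apply: mem_set; exists 1, 1; split; first exact: ideal1N.
  by rewrite rmorph1 divr1.
- move=> x y /set_mem[m [d [Pd ->]]] /set_mem[n [e [Pe ->]]]; apply: mem_set.
  exists (m * e - n * d), (d * e); split; first exact: notP_mul.
  have [d0 e0] : tofrac d != 0 /\ tofrac e != 0.
    by rewrite !tofrac_eq0 !notP_neq0.
  by rewrite -mulNr addf_div // rmorphB !rmorphM mulNr.
- move=> x y /set_mem[m [d [Pd ->]]] /set_mem[n [e [Pe ->]]]; apply: mem_set.
  exists (m * n), (d * e); split; first exact: notP_mul.
  by rewrite mulf_div !rmorphM.
Qed.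

(** For a nonzero a in P, an equality 1/a = n/d gives d = na in P, so 1/a has no denominator outside
    P. *)
Lemma localization_neqT : P != [set 0] -> localization P <> setT.
Proof.
move=> /(ideal_nonzero idP)[a Pa a0] PT.
have [n [d [Pd /eqP]]] : localization P (tofrac a)^-1 by rewrite PT.
rewrite -div1r eqr_div ?tofrac_eq0 ?a0 ?notP_neq0 // mul1r -rmorphM tofrac_eq.
by move=> /eqP dE; apply: Pd; rewrite dE; exact: idealMl.
Qed.

Lemma localization_inv a : ~ P a -> localization P (tofrac a)^-1.
Proof. by move=> Pa; exists 1, a; rewrite rmorph1 div1r. Qed.

End Localization.

(** * The two implications *)

Section TLinked.
Variable R : idomainType.
Hypothesis R_not_field : ~ GRing.field_axiom R.

Lemma exists_nonzero_nonunit : exists2 a : R, a != 0 & a \isn't a GRing.unit.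
Proof.
apply: contrapT => noa; apply: R_not_field => a a0.
by apply: contrapT => /negP aU; apply: noa; exists a.
Qed.

Lemma neq_set0 (P : set R) a : P a -> a != 0 -> P != [set 0].
Proof.
by move=> Pa a0; apply/eqP => P0; move: Pa a0; rewrite P0 => ->; rewrite eqxx.
Qed.

Lemma t_linked_prime (P : set R) :
  t_linked_under (localization P) -> prime_ideal P -> P != [set 0] ->
  P = [set a | a \isn't a GRing.unit].
Proof.
move=> tlP prP Pn0; have [idP _] := prP.
apply/seteqP; split=> [a|a /= aNU]; first exact: ideal_unitN.
apply: contrapT => Pa; move/negP: aNU; apply.
have a0 : a != 0 by apply: contra_notN Pa => /eqP ->; exact: ideal0.
pose I := [set x | exists c : 'I_1 -> R, x = \sum_(i < 1) c i * a].
have : ideal_inverse I (tofrac a)^-1.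
  move=> _ [_ [c ->] <-]; exists (c 0) => //.
  by rewrite big_ord1 rmorphM mulrC mulfK // tofrac_eq0.
rewrite tlP; last 2 first.
- by exists 1%N, (fun=> a).
- apply: colon_unit => //; first exact: localization_overring.
  exact: localization_inv.
move=> [b _ ba]; apply/unitrP; exists b.
suff ba1 : b * a = 1 by rewrite [a * b]mulrC ba1.
by apply/eqP; rewrite -tofrac_eq tofracM ba tofrac1 mulVf // tofrac_eq0.
Qed.

Lemma t_linked_dim1_local :
  (forall T : set {fraction R}, overring T -> T <> setT -> t_linked_under T) ->
  has_krull_dim R 1 /\ local_domain R.
Proof.
move=> tl; pose N := [set a : R | a \isn't a GRing.unit].
have prE P : prime_ideal P -> P != [set 0] -> P = N.
  move=> prP Pn0; apply: t_linked_prime => //; apply: tl.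
    exact: localization_overring.
  exact: localization_neqT.
have [a a0 aNU] := exists_nonzero_nonunit.
have [P [prP maxP Pa]] := exists_maximal_prime_nonunit aNU.
have PE : P = N by apply: prE => //; exact: neq_set0 Pa a0.
subst P; split; last first.
  (* A maximal ideal consists of nonunits, so it lies in the proper ideal [N] and equals it. *)
  exists N; split=> // M [idM Mmax].
  by apply: Mmax; [case: maxP | move=> x; exact: ideal_unitN].
split.
  exists (fun i => if i is 0 then [set 0] else N); split=> [[|i] _|[|i]] //.
    exact: set0_prime.
  move=> _; split; first by move=> _ ->; apply: ideal0; case: maxP.
  by move=> /(_ a Pa) /= az; rewrite az eqxx in a0.
(* In a chain of length at least 2, [Q 1] and [Q 2] strictly contain their predecessors, so both are
   nonzero and equal [N], against their strict inclusion. *)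
move=> [|[|m]] Q [prQ ltQ] //.
have nz i : (i < m.+2)%N -> Q i.+1 != [set 0].
  move=> im; have [sQ nQ] := ltQ i im.
  apply/eqP => Q0; apply: nQ => x; rewrite Q0 => ->.
  by apply: ideal0; case: (prQ i (ltnW im)).
have Q1 : Q 1%N = N by apply: prE; [exact: prQ | exact: nz].
have Q2 : Q 2%N = N by apply: prE; [exact: prQ | exact: nz].
by have [_] := ltQ 1%N isT; rewrite Q1 Q2; case.
Qed.

Lemma dim1_local_power (a x : R) : has_krull_dim R 1 -> local_domain R ->
  a != 0 -> x \isn't a GRing.unit -> exists k b, x ^+ k = b * a.
Proof.
move=> [_ dim] [M [maxM uniqM]] a0 xNU; apply: contrapT => noxk.
have locM K : maximal_ideal K -> K = M by move=> /uniqM.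
have [M' [prM /locM ? Mx]] := exists_maximal_prime_nonunit xNU; subst M'.
have [|s t [i <-] [j <-]||P [prP sP Px _]] :=
    @exists_avoiding_prime R [set y | exists k, x ^+ k = y] _ _
      (range ( *%R^~ a)).
- by exists 0%N.
- by exists (i + j)%N; rewrite exprD.
- split; last by move=> _ [k <-] [b _ xk]; apply: noxk; exists k, b.
  (* Were [a] a unit, already the zeroth power of [x] would be a multiple of [a]. *)
  apply: principal_proper; apply/negP => aU; apply: noxk; exists 0%N, a^-1.
  by rewrite mulVr.
have Pa : P a by apply: sP; exists 1; rewrite ?mul1r.
have [idP _] := prP.
have [M' [_ /locM ? sPM]] := exists_maximal_prime idP; subst M'.
(* The default value [M] of [nth] supplies the top of the chain 0 < [P] < [M], where [x] separates
   [P] from [M]. *)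
suff /dim : prime_chain 2 (fun i => nth M [:: [set 0]; P] i) by [].
split=> [[|[|[|]]]|[|[|]]] //= _.
- exact: set0_prime.
- split; first by move=> _ ->; exact: ideal0.
  by move=> /(_ a Pa) /= az; rewrite az eqxx in a0.
- split=> // /(_ x Mx) Px'.
  by apply: (Px x) => //; exists 1%N.
Qed.

Lemma dim1_local_t_linked (T : set {fraction R}) :
  has_krull_dim R 1 -> local_domain R ->
  overring T -> T <> setT -> t_linked_under T.
Proof.
move=> dim loc ovT /(overring_noninvertible ovT)[a a0 TaV] _ [n [g ->]] colT.
have [/existsP[i gU]|/existsPn gNU] := boolP [exists i, g i \is a GRing.unit].
  apply/seteqP; split=> [x Ix|_ [r _ <-] _ [s _ <-]]; last first.
    by exists (r * s); rewrite ?rmorphM.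
  rewrite -[x]mulr1 -(rmorph1 (@tofrac R)); apply: Ix; exists 1 => //=.
  (* These coefficients write 1 as a combination of the generators, so I = R. *)
  exists (fun j => if j == i then (g i)^-1 else 0).
  rewrite (bigD1 i) //= eqxx mulVr // big1 ?addr0 // => j /negPf ->.
  by rewrite mul0r.
have /choice[k kP] i : exists k, exists b, g i ^+ k = b * a.
  exact: dim1_local_power.
(* With y = 1/a, each y g_i^(k_i) equals some b in R, hence lies in T. *)
case: TaV; apply: (colon_power ovT (k := k) colT) => i.
have [b gk] := kP i; rewrite -rmorphXn gk rmorphM mulrC mulfK ?tofrac_eq0 //.
exact: overring_tofrac.
Qed.

End TLinked.

Theorem proposition5p2 (R : idomainType) (R_not_field : ~ GRing.field_axiom R) :
  (forall T : set {fraction R},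
      overring T -> T <> [set: {fraction R}]%classic -> t_linked_under T)
  <-> (has_krull_dim R 1 /\ local_domain R).
Proof.
split=> [|[dim loc] T]; first exact: t_linked_dim1_local.
exact: dim1_local_t_linked.
Qed.
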